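(* Let $A\in\mathbb{R}^{m\times n}$ have rows $a_{1.},\dots,a_{m.}$ and columns $a_{.1},\dots,a_{.n}$, let $b\in\mathbb{R}^m$, and let $\hat{x}\in\mathbb{R}^n$ be a mixed integer feasible solution, i.e. $A\hat{x}=b$, $\hat{x}\ge 0$, and $\hat{x}_j\in\mathbb{Z}$ for $j=q+1,\dots,n$. Let $\mathcal{I}=\{i\in\{1,\dots,n\}:\hat{x}_i>0\}$ and $\bar{\mathcal{I}}=\{i\in\{1,\dots,n\}:\hat{x}_i=0\}$. Consider the optimization problem $[\mathrm{IOP}(\hat{x})]$ in the variables $c\in\mathbb{R}^n$, $y\in\mathbb{R}^m$, $\varepsilon=(\varepsilon_i)_{i\in\mathcal{I}}$, $s=(s_i)_{i\in\bar{\mathcal{I}}}$: $$\begin{aligned} \min\ & \sum_{i\in\mathcal{I}}\varepsilon_i\\ \text{s.t. } & a_{.i}^\top y+\frac{\varepsilon_i}{\hat{x}_i}-c_i=0, && i\in\mathcal{I},\\ & a_{.i}^\top y+s_i-c_i=0, && i\in\bar{\mathcal{I}},\\ & \|c\|_1=1, &&\\ & \varepsilon_i\ge 0,\ i\in\mathcal{I};\quad s_i\ge 0,\ i\in\bar{\mathcal{I}}. && \end{aligned}$$ Then for any nonzero row $a_{p.}$ of $A$ ($p\in\{1,\dots,m\}$), an optimal solution to $[\mathrm{IOP}(\hat{x})]$ is given by $$y^*=\frac{e_p}{\|a_{p.}\|_1},\qquad c^*=\frac{a_{p.}}{\|a_{p.}\|_1},\qquad s^*=0,\qquad \varepsilon^*=0,$$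 where $e_p\in\mathbb{R}^m$ is the unit vector whose $p$th component is $1$.
   Context: Here $q\in\{0,\dots,n\}$ is fixed; the forward mixed integer problem is $\min\{c^\top x: Ax=b,\ x\ge 0,\ x_j \text{ integer for } j=q+1,\dots,n\}$. $\|\cdot\|_1$ is the $\ell_1$ norm. The row $a_{p.}$ is identified with a vector in $\mathbb{R}^n$. *)

(* Defs.v *)
From mathcomp Require Export all_boot all_order all_algebra.
From mathcomp Require Export reals.
Set Implicit Arguments.
Unset Strict Implicit.
Unset Printing Implicit Defensive.
Import Order.TTheory GRing.Theory Num.Theory.
Local Open Scope ring_scope.

(* Not `|v|, which on matrices denotes the max norm in MathComp-Analysis. *)
Definition norm1 (R : realType) (k : nat) (v : 'cV[R]_k) : R :=
  \sum_(i < k) `|v i 0|.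

(* Coordinates are numbered from 0, so the integrality constraints on the
   coordinates q+1, ..., n (numbered from 1) are those with q <= j here. *)
Definition mip_feasible (R : realType) (m n q : nat)
    (A : 'M[R]_(m, n)) (b : 'cV[R]_m) (x : 'cV[R]_n) : Prop :=
  [/\ A *m x = b,
      forall j : 'I_n, 0 <= x j 0 &
      forall j : 'I_n, (q <= j)%N -> x j 0 \is a Num.int].

Definition pos_idx (R : realType) (n : nat) (x : 'cV[R]_n) : {set 'I_n} :=
  [set i | 0 < x i 0].

Definition zero_idx (R : realType) (n : nat) (x : 'cV[R]_n) : {set 'I_n} :=
  [set i | x i 0 == 0].

Record iop_point (R : realType) (m n : nat) (x : 'cV[R]_n) := IopPoint {
  iop_c : 'cV[R]_n;
  iop_y : 'cV[R]_m;
  iop_eps : {i : 'I_n | i \in pos_idx x} -> R;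
  iop_s : {i : 'I_n | i \in zero_idx x} -> R
}.

Definition iop_objective (R : realType) (m n : nat) (x : 'cV[R]_n)
    (v : iop_point m x) : R :=
  \sum_(i : {i : 'I_n | i \in pos_idx x}) iop_eps v i.

Definition iop_feasible (R : realType) (m n : nat) (A : 'M[R]_(m, n))
    (x : 'cV[R]_n) (v : iop_point m x) : Prop :=
  [/\ forall i : {i : 'I_n | i \in pos_idx x},
        ((col (val i) A)^T *m iop_y v) 0 0 + iop_eps v i / x (val i) 0
          - iop_c v (val i) 0 = 0,
      forall i : {i : 'I_n | i \in zero_idx x},
        ((col (val i) A)^T *m iop_y v) 0 0 + iop_s v i
          - iop_c v (val i) 0 = 0,
      norm1 (iop_c v) = 1,
      forall i : {i : 'I_n | i \in pos_idx x}, 0 <= iop_eps v i &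
      forall i : {i : 'I_n | i \in zero_idx x}, 0 <= iop_s v i].

Definition iop_optimal (R : realType) (m n : nat) (A : 'M[R]_(m, n))
    (x : 'cV[R]_n) (v : iop_point m x) : Prop :=
  iop_feasible A v /\
  forall w : iop_point m x,
    iop_feasible A w -> iop_objective v <= iop_objective w.

(* Main.v *)
Require Import Defs.
Set Implicit Arguments.
Unset Strict Implicit.
Unset Printing Implicit Defensive.
Import Order.TTheory GRing.Theory Num.Theory.
Local Open Scope ring_scope.

(** The objective is a sum of nonnegative variables, so any feasible point
    with all the [eps] equal to zero is optimal. With [eps] and [s] both zero,
    the dual constraints say exactly that [c] is the combination of the rows
    of [A] with coefficients [y]; hence a single row with its unit vector [y]
    satisfies them. These equations are homogeneous in [(c, y)], so that row
    can be rescaled to meet the normalization [norm1 c = 1], provided that it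
    is nonzero ([norm1_normalize]). *)

Lemma norm1_eq0 (R : realType) (k : nat) (v : 'cV[R]_k) :
  (norm1 v == 0) = (v == 0).
Proof.
apply/idP/eqP => [|->]; last first.
  by rewrite /norm1 big1 // => i _; rewrite mxE normr0.
rewrite psumr_eq0 => [/allP v0|//].
apply/matrixP => i j; rewrite ord1 mxE; apply/eqP.
by rewrite -normr_eq0; apply: v0; rewrite mem_index_enum.
Qed.

Lemma norm1Z (R : realType) (k : nat) (a : R) (v : 'cV[R]_k) :
  norm1 (a *: v) = `|a| * norm1 v.
Proof.
by rewrite /norm1 mulr_sumr; apply: eq_bigr => i _; rewrite mxE normrM.
Qed.

Lemma norm1_normalize (R : realType) (k : nat) (v : 'cV[R]_k) :
  v != 0 -> norm1 ((norm1 v)^-1 *: v) = 1.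
Proof.
move=> v0; rewrite norm1Z ger0_norm ?invr_ge0 ?sumr_ge0 //.
by rewrite mulVf // norm1_eq0.
Qed.

Lemma col_mul_delta (R : realType) (m n : nat) (A : 'M[R]_(m, n)) (a : R)
    (p : 'I_m) (j : 'I_n) :
  ((col j A)^T *m (a *: delta_mx p 0 : 'cV_m)) 0 0 = (a *: (row p A)^T) j 0.
Proof. by rewrite -scalemxAr -colE !mxE. Qed.

Theorem proposition1 (R : realType) (m n q : nat) (hq : (q <= n)%N)
    (A : 'M[R]_(m, n)) (b : 'cV[R]_m) (xhat : 'cV[R]_n)
    (hx : mip_feasible q A b xhat)
    (p : 'I_m) (hp : row p A != 0) :
  iop_optimal A
    (IopPoint (x := xhat)
       ((norm1 (row p A)^T)^-1 *: (row p A)^T)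
       ((norm1 (row p A)^T)^-1 *: delta_mx p 0)
       (fun _ => 0)
       (fun _ => 0)).
Proof.
split; last first.
  move=> w [_ _ _ eps_ge0 _]; rewrite /iop_objective /= big1 //.
  by apply: sumr_ge0.
split=> //= [i|i|].
- by rewrite col_mul_delta mul0r addr0 subrr.
- by rewrite col_mul_delta addr0 subrr.
- by apply: norm1_normalize; rewrite trmx_eq0.
Qed.
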